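(* Let $n\ge 1$ and let $\chi\colon E(K_n)\to[4]$ be any colouring of the edges of the complete graph $K_n$ on vertex set $[n]$ with $4$ colours. Then there are sets $A_1,A_2,A_3\subseteq[n]$ with $A_1\cup A_2\cup A_3=[n]$ and colours $c_1,c_2,c_3\in[4]$ (not necessarily distinct) such that for each $i\in\{1,2,3\}$ the graph $K_n[A_i,c_i]$ is connected and of diameter at most $160$.
   Context: $[m]=\{1,\dots,m\}$. Edge colourings are arbitrary (adjacent edges may receive the same colour). For a set of vertices $A$ and a colour $c$, $K_n[A,c]$ denotes the graph with vertex set $A$ and edge set $\{xy\colon x,y\in A,\ x\neq y,\ \chi(xy)=c\}$. *)

(* Defs.v *)
From mathcomp Require Import all_boot.

Set Implicit Arguments.
Unset Strict Implicit.
Unset Printing Implicit Defensive.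

Section Graphs.
Variables (T : finType) (e : rel T).

(* The graph with no vertices is not connected. *)
Definition connected_graph : Prop :=
  0 < #|T| /\ forall x y : T, connect e x y.

Definition walk_of_length (k : nat) (x y : T) : bool :=
  [exists p : k.-tuple T, path e x p && (last x p == y)].

(* Shortest walks have length < #|T|, so the value #|T| occurs exactly when y
   is not reachable from x. *)
Definition graph_dist (x y : T) : nat :=
  find (fun k => walk_of_length k x y) (iota 0 #|T|).

(* Only meaningful for connected graphs, as graph_dist is never infinite. *)
Definition diameter : nat := \max_(x : T) \max_(y : T) graph_dist x y.

End Graphs.

Definition Kedge (n : nat) := {E : {set 'I_n} | #|E| == 2}.

(* Adjacency in K_n[A, c], a graph whose vertex type is A itself. Distinctness
   of x and y is implied, since [set x; y] has to have two elements. *)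
Definition colour_graph (n k : nat) (chi : Kedge n -> 'I_k) (A : {set 'I_n})
    (c : 'I_k) : rel {x : 'I_n | x \in A} :=
  fun x y =>
    [exists E : Kedge n, (val E == [set val x; val y]) && (chi E == c)].

Arguments colour_graph {n k} chi A c _ _.

(* Main.v *)
Require Import Defs.
From mathcomp Require Import all_boot.

Set Implicit Arguments.
Unset Strict Implicit.
Unset Printing Implicit Defensive.

(** Forget distances first: give each vertex its four monochromatic components,
    one per colour. Two vertices always share a component, and the claim becomes
    that three components cover everything. This is the four-colour case of
    Ryser's conjecture for intersecting families, proved by Tuza; it is
    [not_escapable] below, in contrapositive form. The proof picks x and y that
    agree in one label only, so that every point with another value of that
    label agrees with x and with y elsewhere, which leaves few patterns. A
    handful of further points, each chosen to avoid three classes, ends in two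
    points that agree nowhere.

    Components may have large diameter, so the unbounded statement is applied to
    a small set of test vertices instead. Suppose that no three balls of
    radius 74 cover the vertices. Then for any three balls some vertex escapes
    them, and adding such vertices adaptively gives 75 test vertices not covered
    by any three components of the coloured graph that they span
    ([three_balls_cover]). Indeed a component of at most 75 vertices has diameter
    at most 74, so a vertex that escapes a ball is in another component than the
    centre, whatever vertices are added later. This contradicts [not_escapable]. Hence
    three balls of radius 74 cover the vertices; each is connected in its colour
    and has diameter at most 148. *)

(** * Four labellings, any two points agreeing in one of them *)

Section FourLabels.
Variables (I T : Type) (L : eqType) (F : I -> T -> L).

Definition meet_on (i j k l : I) : Prop := forall x y,
  [\/ F i x = F i y, F j x = F j y, F k x = F k y | F l x = F l y].

Lemma meet_on_swap12 i j k l : meet_on i j k l -> meet_on j i k l.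
Proof.
by move=> m x y; case: (m x y) => ?; [apply: Or42|apply: Or41|apply: Or43|apply: Or44].
Qed.

Lemma meet_on_swap23 i j k l : meet_on i j k l -> meet_on i k j l.
Proof.
by move=> m x y; case: (m x y) => ?; [apply: Or41|apply: Or43|apply: Or42|apply: Or44].
Qed.

(** The sets on which one labelling takes one value cannot cover [T] three at a
    time. The labellings i, j, k may coincide: most of the points below are chosen
    to avoid two or three values of the same label. *)
Definition escapable : Prop := forall i j k a b c,
  exists v, [/\ F i v <> a, F j v <> b & F k v <> c].

Definition agree_only (i j k l : I) (x y : T) : Prop :=
  [/\ F i x <> F i y, F j x <> F j y, F k x <> F k y & F l x = F l y].

(** For x and y agreeing only in the last label, write the first three labels of
    x as 000 and those of y as 111, with 2 for any value other than 0 and 1 in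
    its place, and a for the last label of both. Then z is 201b and w is 120b
    with b other than a: they disagree in their first three labels. *)
Definition opposite (i j k l : I) (x y z w : T) : Prop :=
  [/\ [/\ F i z <> F i x, F i z <> F i y, F j z = F j x & F k z = F k y],
      [/\ F i w = F i y, F j w <> F j x, F j w <> F j y & F k w = F k x],
      F l z <> F l x & F l z = F l w].

Lemma opposite_swap i j k l x y z w :
  agree_only i j k l x y -> opposite i j k l x y z w ->
  opposite j i k l y x w z.
Proof.
move=> [? ? ? ?] [[? ? ? ?] [? ? ? ?] ? ?].
by split; [split|split| |]; congruence.
Qed.

(** A point v whose last label is neither a nor b must agree with 000, 111, 201
    and 120 within its first three labels. The only such words are 021, 210
    (where the 2's are those of w and z) and 10*. *)
Lemma opposite_patterns i j k l x y z w v :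
    meet_on i j k l -> agree_only i j k l x y -> opposite i j k l x y z w ->
    F l v <> F l x -> F l v <> F l z ->
  [\/ [/\ F i v = F i x, F j v = F j w & F k v = F k y],
      [/\ F i v = F i z, F j v = F j y & F k v = F k x]
    | F i v = F i y /\ F j v = F j x].
Proof.
move=> meet [? ? ? ?] [[? ? ? ?] [? ? ? ?] ? ?] ? ?.
case: (meet v x) => ?; try congruence;
  case: (meet v y) => ?; try congruence;
  case: (meet v z) => ?; try congruence;
  case: (meet v w) => ?; try congruence;
  first [ by apply: Or31; split; congruence
        | by apply: Or32; split; congruence
        | by apply: Or33; split; congruence ].
Qed.

(** Suppose that the pattern 021 occurs, at s. Every 210 outside a and b would
    have the same last label d as s, and then a point outside a, b and d would be
    10* and would have to agree with both in the third label, which is absurd.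
    So outside a and b only 021 and 10* occur, and the first label there is 0
    or 1. Choosing a point q of the form 10* with * other than 1 forces all 021
    to have the last label of q. A point t outside a, b and d is then 101. Finally
    a point r that avoids 0 and 1 in the first label and b in the last must have
    the last label a, and it cannot agree with all of q, t, s and w. *)
Lemma opposite_pattern_contra i j k l x y z w s :
    meet_on i j k l -> escapable ->
    agree_only i j k l x y -> opposite i j k l x y z w ->
    F l s <> F l x -> F l s <> F l z ->
    [/\ F i s = F i x, F j s = F j w & F k s = F k y] ->
  False.
Proof.
move=> meet esc xy zw sx sz [si sj sk].
have pat v := opposite_patterns meet xy zw (v := v).
case: (xy) (zw) => [? ? ? ?] [[? ? ? ?] [? ? ? ?] ? ?].
have pat' v : F l v <> F l x -> F l v <> F l z ->
    [/\ F i v = F i x, F j v = F j w & F k v = F k y]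
    \/ (F i v = F i y /\ F j v = F j x).
  move=> vx vz; case: (pat v vx vz) => [?|[? ? ?]|?]; [by left| |by right].
  have lv : F l v = F l s by case: (meet v s) => ?; congruence.
  have [t [tx tz ts]] := esc l l l (F l x) (F l z) (F l s).
  by case: (pat t tx tz) => [[? ? ?]|[? ? ?]|[? ?]]; case: (meet t s) => ?;
    case: (meet t v) => ?; congruence.
have [q [qx qz qk]] := esc l l k (F l x) (F l z) (F k y).
have [qi qj] : F i q = F i y /\ F j q = F j x.
  by case: (pat' q qx qz) => [[? ? ?]|//]; congruence.
have ql v : F l v <> F l x -> F l v <> F l z -> F i v = F i x ->
    F l v = F l q.
  move=> vx vz ?; case: (pat' v vx vz) => [[? ? ?]|[? ?]];
    by case: (meet v q) => ?; congruence.
have sq := ql s sx sz si.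
have [t [tx tz ts]] := esc l l l (F l x) (F l z) (F l s).
have [ti tj] : F i t = F i y /\ F j t = F j x.
  by case: (pat' t tx tz) => [[ti ? ?]|//]; have := ql t tx tz ti; congruence.
have tk : F k t = F k y by case: (meet t s) => ?; congruence.
have [r [rx ry rz]] := esc i i l (F i x) (F i y) (F l z).
have [rl|/eqP rl] := eqVneq (F l r) (F l x).
  by case: (meet r q) => ?; case: (meet r t) => ?; case: (meet r s) => ?;
    case: (meet r w) => ?; congruence.
by case: (pat' r rl rz) => [[? ? ?]|[? ?]]; congruence.
Qed.

(** Avoiding 1 in the first label gives 021 or 210. Exchanging x with y, z with w
    and the first two labellings exchanges these two patterns. *)
Lemma opposite_contra i j k l x y z w :
    meet_on i j k l -> escapable ->
    agree_only i j k l x y -> opposite i j k l x y z w -> False.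
Proof.
move=> meet esc xy zw.
have [s [sx sz sy]] := esc l l i (F l x) (F l z) (F i y).
have [? ? ? lxy] := xy; have [_ _ _ lzw] := zw.
case: (opposite_patterns meet xy zw sx sz) => [ps|[? ? ?]|[/sy[]]].
  exact: opposite_pattern_contra meet esc xy zw sx sz ps.
apply: (opposite_pattern_contra (meet_on_swap12 meet) esc _
          (opposite_swap xy zw) (s := s)); rewrite -?lxy -?lzw //.
by split=> // /esym.
Qed.

(** In the notation above, z has 2 in place i and its last label is not a. *)
Definition off (i l : I) (x y z : T) : Prop :=
  [/\ F i z <> F i x, F i z <> F i y & F l z <> F l x].

Lemma off_values i j k l x y z :
    meet_on i j k l -> agree_only i j k l x y -> off i l x y z ->
  F j z = F j x /\ F k z = F k y \/ F j z = F j y /\ F k z = F k x.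
Proof.
move=> meet [? ? ? ?] [? ? ?].
by case: (meet z x) => ?; case: (meet z y) => ?; first
  [left; split; congruence|right; split; congruence|congruence].
Qed.

(** Points with 2 in different places among the first three can agree only in the
    third of these places or in the last label. If they agree in the last label
    but not in that place, they form an opposite pair, possibly after exchanging
    x and y. *)
Lemma off_agree i j k l x y z w :
    meet_on i j k l -> escapable -> agree_only i j k l x y ->
    off i l x y z -> off j l x y w ->
  F k z = F k w.
Proof.
move=> meet esc xy oz ow.
have [? ? ? ?] := xy.
have yx : agree_only i j k l y x by split; congruence.
have yx' : agree_only j i k l x y by [].
have vz := off_values meet xy oz.
have vw := off_values (meet_on_swap12 meet) yx' ow.
have [? ? ?] := oz; have [? ? ?] := ow.
case: vz => [[? ?]|[? ?]]; case: vw => [[? ?]|[? ?]]; try congruence;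
  case: (meet z w) => ?; try congruence; exfalso.
  apply: (opposite_contra meet esc xy (z := z) (w := w)).
  by split; [split|split| |]; congruence.
apply: (opposite_contra meet esc yx (z := z) (w := w)).
by split; [split|split| |]; congruence.
Qed.

(** Take points z, w, u with 2 in the first, second and third place. By
    [off_agree] any two of them agree in the place where neither has 2, and by
    [off_values] the two other labels of each point are one 0 and one 1. So the
    values at the three places alternate around a triangle, which is impossible. *)
Theorem not_escapable i j k l (x : T) : meet_on i j k l -> ~ escapable.
Proof.
move=> mijk esc.
have [y [yi yj yk]] := esc i j k (F i x) (F j x) (F k x).
have xy : agree_only i j k l x y by case: (mijk x y) => ?; split; congruence.
have [? ? ? ?] := xy.
have [z oz] := esc i i l (F i x) (F i y) (F l x).
have [w ow] := esc j j l (F j x) (F j y) (F l x).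
have [u ou] := esc k k l (F k x) (F k y) (F l x).
have mikj := meet_on_swap23 mijk.
have mjki := meet_on_swap23 (meet_on_swap12 mijk).
have zw := off_agree mijk esc xy oz ow.
have zu : F j z = F j u by apply: off_agree mikj esc _ oz ou.
have wu : F i w = F i u by apply: off_agree mjki esc _ ow ou.
have vz := off_values mijk xy oz.
have [vw vu] : (F k w = F k x /\ F i w = F i y \/ F k w = F k y /\ F i w = F i x)
   /\ (F i u = F i x /\ F j u = F j y \/ F i u = F i y /\ F j u = F j x).
  split; first by apply: (off_values mjki _ ow).
  by apply: (off_values (meet_on_swap12 mikj) _ ou).
by case: vz vw vu => [[? ?]|[? ?]] [[? ?]|[? ?]] [[? ?]|[? ?]]; congruence.
Qed.
End FourLabels.

(** * A bounded set of test vertices *)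

Section Balls.
Variables (V : finType) (e : rel V).

Definition ball (r : nat) (x : V) : {set V} :=
  iter r (fun B => B :|: [set v | [exists u in B, e u v]]) [set x].

Lemma ballS r x v :
  (v \in ball r.+1 x) = (v \in ball r x) || [exists u in ball r x, e u v].
Proof. by rewrite /ball iterS !inE. Qed.

Lemma ball_mono r s x : r <= s -> ball r x \subset ball s x.
Proof.
move=> /subnKC <-; elim: (s - r) => [|d IHd]; first by rewrite addn0.
by rewrite addnS; apply: subset_trans IHd (subsetUl _ _).
Qed.

(** Walks that may stay in place are allowed, since different test vertices may be
    the same vertex of the graph. *)
Lemma path_ball r x p :
  path (fun u v => (u == v) || e u v) x p -> size p <= r -> last x p \in ball r x.
Proof.
elim/last_ind: p r => [|p v IHp] [|r] //=.
- by rewrite inE.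
- by move=> _ _; apply: (subsetP (ball_mono x (leq0n r.+1))); rewrite inE.
- by rewrite size_rcons.
rewrite rcons_path last_rcons size_rcons ltnS ballS => /andP[pp /orP[/eqP <-|uv]] sp.
  by rewrite IHp.
by apply/orP; right; apply/existsP; exists (last x p); rewrite IHp.
Qed.

End Balls.

Section TestVertices.
Variables (V : finType) (adj : 'I_4 -> rel V) (x0 : V).
Hypothesis adj_sym : forall c, symmetric (adj c).
Hypothesis adj_total : forall x y, x != y -> exists c, adj c x y.

(** Splitting the colours into two pairs lets one test vertex escape the balls
    around [x0] in both colours of a pair. This halves the second and third
    level of the tree of test vertices, which has 1 + 2 + 8 + 64 nodes instead of
    1 + 4 + 16 + 64; the latter would give diameters up to 168. *)
Definition colour_pair (h b : bool) : 'I_4 := inord (h.*2 + b).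

Lemma colour_pairP c : exists h b, c = colour_pair h b.
Proof.
case: c => [[|[|[|[|c]]]] hc] //.
- by exists false, false; apply: val_inj; rewrite /= inordK.
- by exists false, true; apply: val_inj; rewrite /= inordK.
- by exists true, false; apply: val_inj; rewrite /= inordK.
- by exists true, true; apply: val_inj; rewrite /= inordK.
Qed.

Definition node : finType :=
  (unit + bool + bool * 'I_4 + bool * bool * 'I_4 * 'I_4)%type.

Lemma card_node : #|{: node}| = 75.
Proof. by rewrite !card_sum !card_prod card_unit card_bool card_ord. Qed.

(** Nodes that stand for the same vertex are made adjacent in all colours, so that
    any two nodes have a common component in some colour. *)
Definition pulled_adj (N : finType) (p : N -> V) (c : 'I_4) : rel N :=
  fun s t => (p s == p t) || adj c (p s) (p t).

(** A shortest path visits each node at most once, so a component of the pulled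
    back graph stays within distance #|N| - 1 of each of its nodes. *)
Lemma connect_ball (N : finType) (p : N -> V) c s t :
  connect (pulled_adj p c) s t -> p t \in ball (adj c) #|N|.-1 (p s).
Proof.
case/connectP=> q0 q0s ->; case: (shortenP q0s) => q qs uq _ {q0 q0s}.
rewrite -last_map; apply: path_ball; first by rewrite path_map.
rewrite size_map -ltnS prednK; last by apply/card_gt0P; exists s.
by rewrite -[X in X <= _]/(size (s :: q)) -(card_uniqP uq) max_card.
Qed.

(** Three components of the tree of test vertices that cover it would be found
    from the root down: one contains the root, the second a child chosen to escape
    the first, the third a grandchild that escapes the first two, and the leaf
    that escapes all three is not covered. *)
Theorem three_balls_cover : exists c1 c2 c3 x1 x2 x3,
  ball (adj c1) 74 x1 :|: ball (adj c2) 74 x2 :|: ball (adj c3) 74 x3 = [set: V].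
Proof.
(* The radius is made abstract, as a ball of radius 74 would otherwise be
   unfolded into 74 nested unions. *)
have [R RE] : exists R, R = 74 by exists 74.
rewrite -RE.
pose B (K : 'I_4 * V) := ball (adj K.1) R K.2.
pose covers q := [forall v, v \in B q.1.1 :|: B q.1.2 :|: B q.2].
have [/existsP[[[[c1 x1] [c2 x2]] [c3 x3]] /forallP cov]|ncov] :=
  boolP [exists q, covers q].
  exists c1, c2, c3, x1, x2, x3; apply/setP => v; rewrite [RHS]inE.
  exact: cov.
exfalso.
have /fin_all_exists[f fP] (q : ('I_4 * V) * ('I_4 * V) * ('I_4 * V)) :
    exists v, [/\ v \notin B q.1.1, v \notin B q.1.2 & v \notin B q.2].
  move: ncov; rewrite negb_exists => /forallP/(_ q).
  rewrite negb_forall => /existsP[v].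
  by rewrite !in_setU !negb_or -andbA => /and3P[]; exists v.
pose triple : Type := (('I_4 * V) * ('I_4 * V) * ('I_4 * V))%type.
(* The node [y h] has only two balls to escape, so the second one is repeated. *)
pose qy h : triple := ((colour_pair h false, x0), (colour_pair h true, x0),
              (colour_pair h true, x0)).
pose y h := f (qy h).
pose qz h c : triple := ((colour_pair h false, x0), (colour_pair h true, x0), (c, y h)).
pose z h c := f (qz h c).
pose qt h b c d : triple := ((colour_pair h b, x0), (c, y h), (d, z h c)).
pose t h b c d := f (qt h b c d).
pose p (s : node) : V := match s with
  | inl (inl (inl _)) => x0
  | inl (inl (inr h)) => y h
  | inl (inr (h, c)) => z h c
  | inr (h, b, c, d) => t h b c d
  end.
pose X : node := inl (inl (inl tt)).
pose Y h : node := inl (inl (inr h)).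
pose Z h c : node := inl (inr (h, c)).
pose W h b c d : node := inr (h, b, c, d).
pose E := pulled_adj p.
have E_sym c : connect_sym (E c).
  apply: sym_connect_sym => s s'.
  by rewrite /E /pulled_adj eq_sym adj_sym.
pose F c := root (E c).
have farF c s s' : p s' \notin B (c, p s) -> F c s' <> F c s.
  move=> far /esym/eqP; rewrite root_connect // => /connect_ball.
  by rewrite card_node -RE; apply/negP.
have FY h b : F (colour_pair h b) (Y h) <> F (colour_pair h b) X.
  by apply: farF; case: b; case: (fP (qy h)).
have FZX h b c : F (colour_pair h b) (Z h c) <> F (colour_pair h b) X.
  by apply: farF; case: b; case: (fP (qz h c)).
have FZY h c : F c (Z h c) <> F c (Y h).
  by apply: farF; case: (fP (qz h c)).
have FW h b c d : [/\ F (colour_pair h b) (W h b c d) <> F (colour_pair h b) X,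
    F c (W h b c d) <> F c (Y h) & F d (W h b c d) <> F d (Z h c)].
  by case: (fP (qt h b c d)); split; apply: farF.
pose hit (K : 'I_4 * node) v := F K.1 v = K.2.
have chain K1 K2 K3 : (forall v, [\/ hit K1 v, hit K2 v | hit K3 v]) ->
    hit K1 X -> False.
  move: K1 K2 K3 => [c1 a1] [c2 a2] [c3 a3]; rewrite /hit /=.
  have [h [b ->]] := colour_pairP c1; move=> cov e1; rewrite -{}e1 in cov.
  have chain2 c d a a' : (forall v,
      [\/ F (colour_pair h b) v = F (colour_pair h b) X, F c v = a | F d v = a']) ->
      F c (Y h) = a -> False.
    move=> cov' ea; rewrite -{}ea in cov'.
    case: (cov' (Z h c)) => [/FZX//|/FZY//|ed]; rewrite -{}ed in cov'.
    by case: (FW h b c d) => ? ? ?; case: (cov' (W h b c d)).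
  case: (cov (Y h)) => [/FY//|e2|e3]; first exact: chain2 cov e2.
  apply: (chain2 c3 c2 a3 a2) e3 => v.
  by case: (cov v) => ?; [apply: Or31|apply: Or33|apply: Or32].
apply: (not_escapable (F := F) (i := inord 0) (j := inord 1) (k := inord 2)
  (l := inord 3) X).
- move=> s s'.
  have [c cE] : exists c, E c s s'.
    have [pss'|/adj_total[c ac]] := eqVneq (p s) (p s').
      by exists ord0; rewrite /E /pulled_adj pss' eqxx.
    by exists c; rewrite /E /pulled_adj ac orbT.
  have /eqP : F c s == F c s' by rewrite root_connect // connect1.
  have -> : c = inord c by rewrite inord_val.
  case: c {cE} => [[|[|[|[|c]]]] hc] //= ?;
    by [apply: Or41|apply: Or42|apply: Or43|apply: Or44].
- move=> i j k a b c.
  have [/existsP[v /and3P[/eqP ? /eqP ? /eqP ?]]|] :=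
    boolP [exists v, [&& F i v != a, F j v != b & F k v != c]].
    by exists v.
  rewrite negb_exists => /forallP cov; exfalso.
  have {}cov v : [\/ hit (i, a) v, hit (j, b) v | hit (k, c) v].
    have := cov v; rewrite !negb_and !negbK.
    by case/or3P => /eqP; [apply: Or31|apply: Or32|apply: Or33].
  case: (cov X); [apply: chain cov| |].
    by apply: (chain (j, b) (i, a) (k, c)) => v; case: (cov v) => ?;
      [apply: Or32|apply: Or31|apply: Or33].
  by apply: (chain (k, c) (i, a) (j, b)) => v; case: (cov v) => ?;
      [apply: Or32|apply: Or33|apply: Or31].
Qed.

End TestVertices.

(** * From balls to diameters *)

Section Diameter.
Variables (T : finType) (e : rel T).

(** Going through the centre joins any two vertices by a walk of length at most 2r.
    It need not be a shortest walk, but [graph_dist] takes the least length. *)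
Lemma connected_diameter_le (r : nat) (x : T) : symmetric e ->
    (forall v, exists p, [/\ path e x p, last x p = v & size p <= r]) ->
  connected_graph e /\ diameter e <= r + r.
Proof.
move=> e_sym reach.
have walk u v : exists2 p, path e u p /\ last u p = v & size p <= r + r.
  have [p [pp pu sp]] := reach u; have [q [pq qv sq]] := reach v.
  exists (rev (belast x p) ++ q); last first.
    by rewrite size_cat size_rev size_belast leq_add.
  have lp : last u (rev (belast x p)) = x.
    by case: (p) pu => [<-//|a p' _]; rewrite /= rev_cons last_rcons.
  rewrite cat_path last_cat lp pq -pu rev_path; split=> //.
  by rewrite andbT (eq_path (e' := e)) // => a b; rewrite e_sym.
split.
  split; first by apply/card_gt0P; exists x.
  by move=> u v; have [p [pp <-] _] := walk u v; apply/connectP; exists p.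
apply/bigmax_leqP => u _; apply/bigmax_leqP => v _.
rewrite /graph_dist leqNgt; apply/negP => long.
have [p [pp pv] sp] := walk u v.
have lt_p := leq_ltn_trans sp long.
have := before_find 0 lt_p; rewrite nth_iota; last first.
  by apply: leq_trans lt_p _; rewrite -[X in _ <= X](size_iota 0) find_size.
rewrite add0n => /negbT/negP[]; apply/existsP; exists (in_tuple p).
by rewrite /= pp pv eqxx.
Qed.

End Diameter.

Section Colours.
Variables (n : nat) (chi : Kedge n -> 'I_4).

Definition colour_adj (c : 'I_4) : rel 'I_n := fun x y =>
  [exists E : Kedge n, (val E == [set x; y]) && (chi E == c)].

Lemma colour_adj_sym c : symmetric (colour_adj c).
Proof. by move=> x y; rewrite /colour_adj setUC. Qed.

Lemma colour_adj_total x y : x != y -> exists c, colour_adj c x y.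
Proof.
move=> xy; have xy2 : #|[set x; y]| == 2 by rewrite cards2 xy.
pose E : Kedge n := exist (fun S : {set 'I_n} => #|S| == 2) [set x; y] xy2.
by exists (chi E); apply/existsP; exists E; rewrite !eqxx.
Qed.

(** Every vertex of a ball is reached from the centre through smaller balls around
    it, hence without leaving the ball. So distances within the induced subgraph are
    as small as in the whole graph. *)
Lemma ball_diameter c r x (A := ball (colour_adj c) r x) :
  connected_graph (colour_graph chi A c) /\
    diameter (colour_graph chi A c) <= r + r.
Proof.
have xA : x \in A by apply: (subsetP (ball_mono _ x (leq0n r))); rewrite inE.
pose inA a (aA : a \in A) : {a | a \in A} := exist _ a aA.
apply: (connected_diameter_le (x := inA x xA)).
  by move=> u v; apply: colour_adj_sym.
have reach k v : k <= r -> v \in ball (colour_adj c) k x ->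
    forall vA : v \in A, exists p, [/\ path (colour_graph chi A c) (inA x xA) p,
      last (inA x xA) p = inA v vA & size p <= k].
  elim: k v => [|k IHk] v kr.
    by rewrite inE => /eqP -> vA; exists [::]; split=> //; apply: val_inj.
  rewrite ballS => /orP[vk vA|/existsP[u /andP[uk uv]] vA].
    by have [p [? ? sp]] := IHk v (ltnW kr) vk vA; exists p; split=> //; apply: leqW.
  have uA := subsetP (ball_mono _ x (ltnW kr)) u uk.
  have [p [pp pu sp]] := IHk u (ltnW kr) uk uA.
  exists (rcons p (inA v vA)).
  by rewrite rcons_path last_rcons size_rcons pp pu.
by case=> v vA; apply: reach.
Qed.

End Colours.

Theorem theorem7 (n : nat) (hn : 1 <= n) (chi : Kedge n -> 'I_4) :
  exists (A1 A2 A3 : {set 'I_n}) (c1 c2 c3 : 'I_4),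
    [/\ A1 :|: A2 :|: A3 = [set: 'I_n],
        connected_graph (colour_graph chi A1 c1) /\
          diameter (colour_graph chi A1 c1) <= 160,
        connected_graph (colour_graph chi A2 c2) /\
          diameter (colour_graph chi A2 c2) <= 160
      & connected_graph (colour_graph chi A3 c3) /\
          diameter (colour_graph chi A3 c3) <= 160].
Proof.
have [c1 [c2 [c3 [x1 [x2 [x3 cov]]]]]] :=
  three_balls_cover (Ordinal hn) (colour_adj_sym chi) (@colour_adj_total n chi).
exists (ball (colour_adj chi c1) 74 x1), (ball (colour_adj chi c2) 74 x2),
  (ball (colour_adj chi c3) 74 x3), c1, c2, c3.
have diam c x : let A := ball (colour_adj chi c) 74 x in
    connected_graph (colour_graph chi A c) /\ diameter (colour_graph chi A c) <= 160.
  by have [conn d] := ball_diameter chi c 74 x; split=> //; apply: leq_trans d _.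
by split=> //; apply: diam.
Qed.
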